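(* Let $d\geq 1$ be an integer and let $\psi:\mathbb{N}\to[0,\infty)$ be a monotonic function with $\psi(n)\to 0$ as $n\to\infty$. Define \[ S_1(\psi)=\{x\in\mathbb{R}:\ |x-p/q|<\psi(q)\ \text{for infinitely many } p/q\in\mathbb{Q}\}, \] and \[ S_d(\psi,\min)=\Big\{\mathbf{x}\in\mathbb{R}^d:\ |x_i-p_i/q_i|<\psi(\min(q_1,\dots,q_d))\ (i=1,\dots,d)\ \text{for infinitely many } (p_1/q_1,\dots,p_d/q_d)\in\mathbb{Q}^d\Big\}, \] where rationals $p/q$, $p_i/q_i$ are written in lowest terms with $q,q_i\in\mathbb{N}$. Then \[ S_d(\psi,\min)=\bigcup_{i=1}^d\big(\mathbb{R}^{i-1}\times S_1(\psi)\times\mathbb{R}^{d-i}\big). \]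
   Formalization: In S_d(ψ,min), ''infinitely many (p_1/q_1,…,p_d/q_d)'' is read as: there is a sequence of solutions in which no coordinate repeats a value; with a merely infinite set of tuples the claim fails for d=2, ψ(1)=1, ψ(n)=0 for n>1. *)

(* Defs.v *)
From mathcomp Require Import all_boot all_order all_algebra.
From mathcomp Require Import all_classical all_reals all_analysis.

Set Implicit Arguments.
Unset Strict Implicit.
Unset Printing Implicit Defensive.

Import Order.TTheory GRing.Theory Num.Theory.
Import numFieldNormedType.Exports.

Local Open Scope classical_set_scope.
Local Open Scope ring_scope.

(* A rational r is (numq r)%:Q / (denq r)%:Q in lowest terms, with 0 < denq r. *)
Definition den (r : rat) : nat := `|denq r|%N.

(* min(q_1, ..., q_d) for d >= 1: starting the iterated minimum from the maximum
   of the same family does not change its value. For d = 0 this is 0. *)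
Definition min_den (d : nat) (r : 'rV[rat]_d) : nat :=
  (\big[minn/(\max_(i < d) den (r ord0 i))]_(i < d) den (r ord0 i))%N.

(* psi is a function on {1, 2, ...}: the value psi 0 is never used. *)
Definition nonneg_fun (R : realType) (psi : nat -> R) : Prop :=
  forall n, (0 < n)%N -> 0 <= psi n.

Definition monotonic (R : realType) (psi : nat -> R) : Prop :=
  (forall m n, (0 < m)%N -> (m <= n)%N -> psi n <= psi m) \/
  (forall m n, (0 < m)%N -> (m <= n)%N -> psi m <= psi n).

Definition S1 (R : realType) (psi : nat -> R) : set R :=
  [set x | infinite_set [set r : rat | `|x - ratr r| < psi (den r)]].

Definition min_approx (R : realType) (d : nat) (psi : nat -> R)
    (x : 'rV[R]_d) : set 'rV[rat]_d :=
  [set r : 'rV[rat]_d |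
    forall i, `|x ord0 i - ratr (r ord0 i)| < psi (min_den r)].

(* "Infinitely many (p_1/q_1, ..., p_d/q_d)" in P, read as infinitely many in
   every coordinate: P contains a sequence of points in which no coordinate
   repeats a value. For d = 1 this says that P is infinite. For d >= 2,
   infinite_set P would be too weak for the approximation by min(q_1, ..., q_d):
   if psi 1 = 1 and psi n = 0 for n > 1, then S1 psi is empty, whereas for every
   x in R^2, fixing an integer p_1 with |x_1 - p_1| < 1 and letting p_2/q_2 run
   over the rationals with |x_2 - p_2/q_2| < 1 gives infinitely many solutions,
   all with min(1, q_2) = 1. *)
Definition infinitely_many (d : nat) (P : set 'rV[rat]_d) : Prop :=
  exists r : nat -> 'rV[rat]_d,
    (forall i, injective (fun k => r k ord0 i)) /\ (forall k, P (r k)).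

Definition Sd_min (R : realType) (d : nat) (psi : nat -> R) : set 'rV[R]_d :=
  [set x | infinitely_many (min_approx psi x)].

Arguments Sd_min {R} d psi.

(* R^(i-1) x A x R^(d-i), with coordinates numbered from 0 *)
Definition cylinder (R : realType) (d : nat) (i : 'I_d) (A : set R) :
    set 'rV[R]_d :=
  [set x : 'rV[R]_d | A (x ord0 i)].

(* Main.v *)
Require Import Defs.
From mathcomp Require Import all_boot all_order all_algebra.
From mathcomp Require Import all_classical all_reals all_analysis.
From mathcomp Require Import ring lra.
Import Order.TTheory GRing.Theory Num.Theory.
Import numFieldNormedType.Exports.
Local Open Scope classical_set_scope.
Local Open Scope ring_scope.

(** If [x] is approximated by a sequence of rational points, the minimal
    denominator is attained at one and the same coordinate [i] for infinitely
    many of them, and their [i]-th coordinates show that [x_i] is in [S1 psi].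
    Conversely, let [p/q] be one of infinitely many approximations of [x_i].
    Then [psi q > 0], and every other coordinate has infinitely many rational
    approximations with error less than [psi q] and denominator at least [q];
    with any of those the minimal denominator is [q]. *)

(** The minimum of two values of [F] is one of them, and the starting value, a maximum over a
    nonempty type, is itself a value of [F]. *)
Lemma bigmin_attained (I : finType) (F : I -> nat) :
  (0 < #|I|)%N -> exists i, (\big[minn/(\max_i F i)]_i F i)%N = F i.
Proof.
move=> I_gt0; apply: (big_ind (fun m => exists i, m = F i)).
- by have [i ->] := @bigop.eq_bigmax I F I_gt0; exists i.
- move=> m n [i ->] [j ->].
  by case: (leqP (F i) (F j)) => _; [exists i|exists j].
- by move=> i _; exists i.
Qed.

Lemma bigmin_le_mem (I : eqType) (s : seq I) (F : I -> nat) (m : nat) (j : I) :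
  j \in s -> (\big[minn/m]_(i <- s) F i <= F j)%N.
Proof.
elim: s => // a s IHs; rewrite inE big_cons geq_min => /predU1P[->|/IHs ->].
  by rewrite leqnn.
by rewrite orbT.
Qed.

Lemma min_den_attained (d : nat) (r : 'rV[rat]_d) :
  (0 < d)%N -> exists i, min_den r = den (r ord0 i).
Proof.
by move=> d_gt0; apply: bigmin_attained; rewrite card_ord.
Qed.

Lemma min_den_le (d : nat) (r : 'rV[rat]_d) (i : 'I_d) :
  (min_den r <= den (r ord0 i))%N.
Proof.
by apply: (@bigmin_le_mem _ _ (fun i => den (r ord0 i))); rewrite mem_index_enum.
Qed.

Lemma infinite_set_notin_seq (T : eqType) (A : set T) (s : seq T) :
  infinite_set A -> exists2 t, A t & t \notin s.
Proof.
move=> Ainf; apply: contrapT => noA; apply: Ainf.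
apply: (@sub_finite_set _ _ [set` s]); last exact: finite_seq.
move=> t At /=; apply: contrapT => /negP ts; apply: noA; by exists t.
Qed.

(** Choose recursively: an infinite [A k] always has a point outside the finite list [past k] of
    points chosen before. *)
Lemma injective_selection (T : choiceType) (A : nat -> set T) :
  (forall k, infinite_set (A k)) ->
  exists f : nat -> T, injective f /\ forall k, A k (f k).
Proof.
move=> Ainf.
have [|next nextP] := @choice (seq T * nat) T
    (fun sk t => A sk.2 t /\ t \notin sk.1).
  move=> [s k] /=.
  by have [t At ts] := infinite_set_notin_seq _ _ s (Ainf k); exists t.
pose fix past k : seq T :=
  if k is k'.+1 then next (past k', k') :: past k' else [::].
pose f k := next (past k, k).
have f_past j k : (j < k)%N -> f j \in past k.
  elim: k => // k IHk; rewrite ltnS leq_eqVlt /= inE => /predU1P[->|/IHk ->].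
    by rewrite eqxx.
  by rewrite orbT.
have f_neq j k : (j < k)%N -> f j <> f k.
  move=> /f_past + fjk; rewrite fjk.
  by apply/negP; have [] := nextP (past k, k).
exists f; split; last by move=> k; have [] := nextP (past k, k).
by move=> j k fjk; case: (ltngtP j k) => // /f_neq; rewrite fjk.
Qed.

(* The fraction [(a N + 1) / N^2] is in lowest terms. *)
Lemma rat_approx_den_ge (R : realType) (x e : R) (n : nat) : 0 < e ->
  exists2 r : rat, `|x - ratr r| < e & (n <= den r)%N.
Proof.
move=> e_gt0.
(* The first entry gives [N > 0] and [N * N >= n]; the second gives [2 / N < e], where [2 / N] will
   bound the error. *)
pose N := maxn n.+1 (Num.truncn (2 / e)).+1.
have N_gt0 : (0 < N)%N by rewrite leq_max.
have N_gt0R : 0 < N%:R :> R by rewrite ltr0n.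
have Ne : 2 / N%:R < e.
  rewrite ltr_pdivrMr // mulrC -ltr_pdivrMr //.
  apply: (lt_le_trans (truncnS_gt _)).
  by rewrite ler_nat leq_maxr.
pose a := Num.floor (x * N%:R).
pose r : rat := (a * N%:Z + 1)%:Q / (N * N)%N%:Z%:Q.
have den_r : den r = (N * N)%N.
  rewrite /den /r coprimeq_den; last first.
    (* Since [a N + 1] is 1 modulo [N], it is coprime to [N], hence to [N * N]. *)
    rewrite /= -[coprime _ _]/(coprimez (a * N%:Z + 1) (N * N)%N%:Z).
    rewrite PoszM coprimezMr andbb.
    by rewrite coprimez_sym /coprimez gcdzMDl gcdz1.
  by rewrite -[_ == 0]/(N * N == 0)%N muln_eq0 orbb -leqn0 leqNgt N_gt0.
exists r; last first.
  rewrite den_r; apply: (@leq_trans N); last exact: leq_pmulr.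
  by apply: (@leq_trans n.+1) => //; rewrite leq_maxl.
have -> : ratr r = a%:~R / N%:R + (N%:R ^+ 2)^-1 :> R.
  rewrite /r fmorph_div /= !ratr_int rmorphD rmorphM /= PoszM rmorphM /=.
  by field; rewrite lt0r_neq0.
apply: le_lt_trans Ne.
(* Here [x N - a] lies in [0, 1) and [1 / N] in (0, 1], so their difference is at most 2 in absolute
   value. *)
have /andP[a_le a_gt] := floor_itv (x * N%:R).
have -> : x - (a%:~R / N%:R + (N%:R ^+ 2)^-1) =
    (x * N%:R - a%:~R - N%:R^-1) / N%:R.
  by field; rewrite lt0r_neq0.
rewrite normrM (@gtr0_norm _ N%:R^-1) ?invr_gt0 //.
rewrite ler_pM2r ?invr_gt0 // ler_norml.
have iN_gt0 : 0 < N%:R^-1 :> R by rewrite invr_gt0.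
have iN_le1 : N%:R^-1 <= 1 :> R by rewrite invf_le1 // ler1n.
rewrite -/a rmorphD /= in a_le a_gt *.
by apply/andP; split; lra.
Qed.

(** A finite set of solutions would miss one whose denominator exceeds all of theirs. *)
Lemma infinite_rat_approx_den_ge (R : realType) (x e : R) (n : nat) : 0 < e ->
  infinite_set [set r : rat | `|x - ratr r| < e /\ (n <= den r)%N].
Proof.
move=> e_gt0 /finite_seqP[s sE].
pose M := (\max_(r <- s) den r)%N.
have [r xr] := rat_approx_den_ge R x e (maxn n M.+1) e_gt0.
rewrite geq_max => /andP[n_le M_lt].
have : [set` s] r by rewrite -sE.
by move=> /= rs; move: M_lt; rewrite ltnNge leq_bigmax_seq.
Qed.

Theorem theorem1p4 (R : realType) (d : nat) (psi : nat -> R)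
    (hd : (1 <= d)%N) (psi_ge0 : nonneg_fun psi) (psi_mono : monotonic psi)
    (psi_cvg0 : psi n @[n --> \oo] --> (0 : R)) :
  Sd_min d psi = \bigcup_(i in [set: 'I_d]) cylinder i (S1 psi).
Proof.
apply/seteqP; split => x.
- move=> [r [r_inj r_approx]]; apply: contrapT => xNS.
  have [m mE] := choice (fun k => min_den_attained _ (r k) hd).
  (* Pigeonhole: if every fibre of [m] were finite, the set of all indices [k] would be a finite
     union of finite sets. *)
  apply: infinite_nat.
  apply: (@sub_finite_set _ _ (\bigcup_(i in [set: 'I_d]) [set k | m k = i])).
    by move=> k _; exists (m k).
  apply: bigcup_finite => // i _; apply: contrapT => m_inf; apply: xNS.
  exists i => // S1_fin; apply: m_inf.
  apply: (@sub_finite_set _ _ ((fun k => r k ord0 i) @^-1`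
      [set q : rat | `|x ord0 i - ratr q| < psi (den q)])).
    by move=> k /= <-; have := r_approx k (m k); rewrite mE.
  (* No value repeats in coordinate [i], so finitely many fractions come from finitely many [k]. *)
  by apply: finite_preimage S1_fin => k l _ _; apply: r_inj.
- move=> [i _ xi].
  have [p [p_inj p_approx]] := injective_selection _ _ (fun=> xi).
  have psi_gt0 k : 0 < psi (den (p k)).
    exact: le_lt_trans (normr_ge0 _) (p_approx k).
  (* Both the tolerance and the denominator bound vary with [k]; selecting injectively in [k] keeps
     every coordinate free of repetitions. *)
  have [f fP] := choice (fun j => injective_selection _ _ (fun k =>
    infinite_rat_approx_den_ge _ (x ord0 j) _ (den (p k)) (psi_gt0 k))).
  pose r k : 'rV[rat]_d := \row_j (if j == i then p k else f j k).
  have rE k j : r k ord0 j = if j == i then p k else f j k by rewrite mxE.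
  have min_r k : min_den (r k) = den (p k).
    apply/eqP; rewrite eqn_leq; apply/andP; split.
      by have := min_den_le _ (r k) i; rewrite rE eqxx.
    have [j ->] := min_den_attained _ (r k) hd.
    by rewrite rE; case: eqP => // _; have [_ /(_ k)[]] := fP j.
  exists r; split=> [j k l|k j] /=.
    by rewrite !rE; case: eqP => _; [exact: p_inj|have [/(_ k l)] := fP j].
  rewrite min_r rE; case: eqP => [->|_]; first exact: p_approx.
  by have [_ /(_ k)[]] := fP j.
Qed.
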